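(* It holds that $$|S_{\rm weight}\setminus S_0|^2\le4\Lambda_{\max}^2(S_{\rm weight}\setminus S_0)\,\frac{\|f_{\rm weight}-\mathbf f^0\|^2}{\lambda_{\rm weight}^2}\,\frac{\|(1/w)_{S_{\rm weight}\setminus S_0}\|_2^2}{\lambda_{\rm init}^2}.$$ If $|S_{\rm weight}\setminus S_0|>s_0$, then $$|S_{\rm weight}\setminus S_0|\le8\Lambda_{\rm sparse}^2(s_0)\,\frac{\|f_{\rm weight}-\mathbf f^0\|^2}{\lambda_{\rm weight}^2s_0}\,\frac{\|(1/w)_{S_{\rm weight}\setminus S_0}\|_2^2}{\lambda_{\rm init}^2}.$$
   Context: Setting (noiseless). $Q$ is a probability measure on a space $\mathcal X$, $\psi_1,\dots,\psi_p\in L_2(Q)$ with $\int\psi_j^2\,dQ=1$ for all $j$, $\Sigma:=(\int\psi_j\psi_k\,dQ)_{j,k}$, $\|\cdot\|$ is the $L_2(Q)$-norm, $f_\beta:=\sum_j\psi_j\beta_j$ for $\beta\in\mathbb R^p$, so $\|f_\beta\|^2=\beta^T\Sigma\beta$. The target is $\mathbf f^0=f_{\beta_{\rm true}}$, $\beta_{\rm true}\in\mathbb R^p$, $S_{\rm true}:=\{j:\beta_{j,{\rm true}}\neq0\}$. For an index set $S$, $(\beta_S)_j:=\beta_j1\{j\in S\}$. Eigenvalues. $\Lambda_{\max}^2(S):=\max_{\|\beta_S\|_2=1}\beta_S^T\Sigma\beta_S$ (and $0$ if $S=\emptyset$); $\Lambda_{\rm sparse}(N):=\max_{|\mathcal N|=N}\Lambda_{\max}(\mathcal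 N)$. For an index set $S$ and $L>0$, $\phi^2(L,S):=\min\{\|f_\beta\|^2/\|\beta_S\|_2^2:\ \beta_S\ne0,\ \|\beta_{S^c}\|_1\le L\sqrt{|S|}\,\|\beta_S\|_2\}$. Oracle. $\mathrm f_S$ is the $L_2(Q)$-projection of $\mathbf f^0$ on the span of $\{\psi_j\}_{j\in S}$; $S_0$ is a minimizer over $S\subset S_{\rm true}$ of $\|\mathrm f_S-\mathbf f^0\|^2+3\lambda_{\rm init}^2|S|/\phi^2(2,S)$ (second term $0$ if $S=\emptyset$, $+\infty$ if $S\ne\emptyset$ and $\phi(2,S)=0$); $s_0:=|S_0|$, with $s_0\ge1$ where $s_0$ appears in a denominator. Weighted Lasso. $\lambda_{\rm init},\lambda_{\rm weight}>0$, $w_1,\dots,w_p\ge0$, $\beta_{\rm weight}\in\arg\min_\beta\{\|f_\beta-\mathbf f^0\|^2+\lambda_{\rm init}\lambda_{\rm weight}\sum_{j=1}^pw_j|\beta_j|\}$, $f_{\rm weight}:=f_{\beta_{\rm weight}}$, $S_{\rm weight}:=\{j:\beta_{j,{\rm weight}}\neq0\}$, and $\|(1/w)_S\|_2^2:=\sum_{j\in S}1/w_j^2$ (if some $w_j=0$ with $j\in S_{\rm weight}\setminus S_0$, the right-hand sides are read as $+\infty$). *)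

(* Defs.v *)
From HB Require Import structures.
From mathcomp Require Import all_boot all_order all_algebra.
From mathcomp Require Import all_classical all_reals all_analysis.

Set Implicit Arguments.
Unset Strict Implicit.
Unset Printing Implicit Defensive.

Import Order.TTheory GRing.Theory Num.Theory.
Import numFieldNormedType.Exports.

Local Open Scope classical_set_scope.
Local Open Scope ring_scope.

(* Vectors of R^p are column vectors; [j] ranges over ['I_p]. *)
Section CoefficientVectors.
Context {R : realType} {p : nat}.
Implicit Types (b : 'cV[R]_p) (S : {set 'I_p}).

(* b_S, still a vector of R^p *)
Definition restr S b : 'cV[R]_p :=
  \col_j (if j \in S then b j 0 else 0).

Definition supp b : {set 'I_p} := [set j | b j 0 != 0]%SET.

Definition l1norm b : R := \sum_j `|b j 0|.

Definition l2norm b : R := Num.sqrt (\sum_j b j 0 ^+ 2).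

(* ||(1/w)_S||_2^2, meaningful only when w does not vanish on S *)
Definition inv_weight_norm2 (w : 'I_p -> R) S : R := \sum_(j in S) (w j ^+ 2)^-1.

(* The whole right-hand side is +oo as soon as w vanishes somewhere on S, even
   when another factor is 0; a product in \bar R would give 0 * +oo = 0. *)
Definition infty_if_zero_weight (w : 'I_p -> R) S (rhs : R) : \bar R :=
  if [exists j in S, w j == 0] then +oo%E else rhs%:E.

End CoefficientVectors.

Section L2.
Context {d : measure_display} {T : measurableType d} {R : realType}.
Variable Q : probability T R.

Definition L2norm (f : T -> R) : R := fine ('N[Q]_2%:E[EFin \o f])%E.

Context {p : nat}.
Variable psi : 'I_p -> T -> R.
Implicit Types (b : 'cV[R]_p) (S : {set 'I_p}).

Definition gram : 'M[R]_p :=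
  \matrix_(j, k) (\int[Q]_x (psi j x * psi k x)).

(* f_b *)
Definition flin b : T -> R := fun x => \sum_j psi j x * b j 0.

Definition span_on S : set (T -> R) := [set flin (restr S b) | b in setT].

(* g is (a version of) the L_2(Q)-projection of f on the span of the psi_j,
   j in S: the point of that span closest to f *)
Definition is_projection S (f g : T -> R) : Prop :=
  span_on S g /\
  forall h, span_on S h -> L2norm (g \- f) <= L2norm (h \- f).

(* Lambda_max^2(S). The unit sphere is compact, so the supremum is a maximum. *)
Definition Lambda_max2 S : R :=
  if S == finset.set0 then 0
  else sup [set ((restr S b)^T *m gram *m restr S b) 0 0
           | b in [set b | l2norm (restr S b) = 1]].

Definition Lambda_max S : R := Num.sqrt (Lambda_max2 S).

(* The default value 0 is harmless: Lambda_max is nonnegative. *)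
Definition Lambda_sparse (N : nat) : R :=
  \big[Num.max/0]_(S : {set 'I_p} | #|S| == N) Lambda_max S.

(* phi^2(L, S), for nonempty S. The ratio is invariant under scaling of b, and
   the constraints with ||b_S||_2 = 1 define a compact set, so the infimum is a
   minimum. *)
Definition phi2 (L : R) S : R :=
  inf [set L2norm (flin b) ^+ 2 / l2norm (restr S b) ^+ 2
      | b in [set b | restr S b != 0 /\
           l1norm (restr (~: S)%SET b) <=
             L * Num.sqrt #|S|%:R * l2norm (restr S b)]].

Definition oracle_penalty (lambda_init : R) S : \bar R :=
  if S == finset.set0 then 0%E
  else if phi2 2 S == 0 then +oo%E
  else (3 * lambda_init ^+ 2 * #|S|%:R / phi2 2 S)%:E.

(* fS S stands for the projection f_S *)
Definition oracle_crit (lambda_init : R) (f0 : T -> R)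
    (fS : {set 'I_p} -> T -> R) S : \bar R :=
  ((L2norm (fS S \- f0) ^+ 2)%:E + oracle_penalty lambda_init S)%E.

Definition is_oracle_set (lambda_init : R) (f0 : T -> R)
    (fS : {set 'I_p} -> T -> R) (Strue S0 : {set 'I_p}) : Prop :=
  S0 \subset Strue /\
  forall S, S \subset Strue ->
    (oracle_crit lambda_init f0 fS S0 <= oracle_crit lambda_init f0 fS S)%E.

Definition weighted_lasso_crit (lambda_init lambda_weight : R)
    (w : 'I_p -> R) (f0 : T -> R) b : R :=
  L2norm (flin b \- f0) ^+ 2
  + lambda_init * lambda_weight * \sum_j w j * `|b j 0|.

Definition is_weighted_lasso (lambda_init lambda_weight : R)
    (w : 'I_p -> R) (f0 : T -> R) b : Prop :=
  forall b', weighted_lasso_crit lambda_init lambda_weight w f0 b <=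
             weighted_lasso_crit lambda_init lambda_weight w f0 b'.

End L2.

(* Main.v *)
Require Import Defs.
From HB Require Import structures.
From mathcomp Require Import all_boot all_order all_algebra.
From mathcomp Require Import all_classical all_reals all_analysis.
From mathcomp Require Import ring lra.

(** For [j] in the support of the weighted Lasso, stationarity along the [j]-th
coordinate gives [|(Sigma (beta_weight - beta_true))_j|
= lambda_init * lambda_weight * w_j / 2]. Dividing by [w_j], summing over a set
[N] of such [j] and applying Cauchy-Schwarz in L_2(Q) bounds [#|N|^2] by
[4 Lambda_max^2(N)] times the stated factors; the first claim is [N = D]. For
the second, let [N] collect [s0] elements of [D] with the smallest [1/w_j^2]:
their sum is at most [s0 / #|D|] times the sum over [D]. This avoids splitting
[D] into blocks and yields the constant 4 instead of 8. *)

Set Implicit Arguments.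
Unset Strict Implicit.
Unset Printing Implicit Defensive.

Import Order.TTheory GRing.Theory Num.Theory.
Import numFieldNormedType.Exports.

Local Open Scope classical_set_scope.
Local Open Scope ring_scope.

(** * Bilinear form of a matrix and its Cauchy-Schwarz inequality *)

Section QuadraticForm.
Context {R : realFieldType} {p : nat} (G : 'M[R]_p).
Implicit Types u v : 'cV[R]_p.

Definition bform u v : R := (u^T *m G *m v) 0 0.

Lemma bform_sum u v : bform u v = \sum_k \sum_j u j 0 * G j k * v k 0.
Proof.
rewrite /bform mxE; apply: eq_bigr => k _; rewrite mxE mulr_suml.
by apply: eq_bigr => j _; rewrite mxE.
Qed.

Lemma bformDl u u' v : bform (u + u') v = bform u v + bform u' v.
Proof. by rewrite /bform linearD /= !mulmxDl mxE. Qed.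

Lemma bformDr u v v' : bform u (v + v') = bform u v + bform u v'.
Proof. by rewrite /bform mulmxDr mxE. Qed.

Lemma bformZl a u v : bform (a *: u) v = a * bform u v.
Proof. by rewrite /bform linearZ /= -!scalemxAl mxE. Qed.

Lemma bformZr a u v : bform u (a *: v) = a * bform u v.
Proof. by rewrite /bform -scalemxAr mxE. Qed.

Lemma bform_suml u v :
  bform u v = \sum_j u j 0 * bform (delta_mx j 0) v.
Proof.
rewrite /bform -mulmxA mxE; apply: eq_bigr => j _.
by rewrite trmx_delta -mulmxA -rowE !mxE.
Qed.

Hypothesis Gsym : G^T = G.

Lemma bformC u v : bform u v = bform v u.
Proof.
rewrite /bform.
have -> : v^T *m G *m u = (u^T *m G *m v)^T.
  by rewrite !trmx_mul trmxK Gsym mulmxA.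
by rewrite [RHS]mxE.
Qed.

Lemma bform_line u v t :
  bform (u + t *: v) (u + t *: v) =
  bform u u + 2 * t * bform u v + t ^+ 2 * bform v v.
Proof.
rewrite bformDl !bformDr !bformZl !bformZr (bformC v u); ring.
Qed.

(** The polynomial [bform (u + t *: v) (u + t *: v)] in [t] is nonnegative; one value of [t]
    suffices. The form may be degenerate, so [bform v v = 0] is a separate case. *)
Lemma bform_CauchySchwarz u v : (forall b, 0 <= bform b b) ->
  bform u v ^+ 2 <= bform u u * bform v v.
Proof.
move=> G0; have [v0|v0] := eqVneq (bform v v) 0.
  have [->|B0] := eqVneq (bform u v) 0; first by rewrite v0 expr0n mulr0.
  (* Here the polynomial is affine in [t] with nonzero slope; this [t] gives it the value -1. *)
  have := G0 (u + (- (bform u u + 1) / (2 * bform u v)) *: v).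
  rewrite bform_line v0.
  have -> : bform u u + 2 * (- (bform u u + 1) / (2 * bform u v)) * bform u v +
   (- (bform u u + 1) / (2 * bform u v)) ^+ 2 * 0 = -1 by field.
  by rewrite lerNr oppr0 ler10.
have vp : 0 < bform v v by rewrite lt_def v0 G0.
(* The minimizer of the quadratic polynomial. *)
have := G0 (u + (- bform u v / bform v v) *: v).
rewrite bform_line.
have -> : bform u u + 2 * (- bform u v / bform v v) * bform u v +
   (- bform u v / bform v v) ^+ 2 * bform v v =
   (bform u u * bform v v - bform u v ^+ 2) / bform v v by field.
by rewrite pmulr_lge0 ?invr_gt0// subr_ge0.
Qed.

End QuadraticForm.

(** Removing an element with the largest [a] never raises the average; repeat until [s] elements
    remain. Averages are compared with denominators cleared, so that empty sets are covered. *)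
Lemma exists_small_subset (R : realFieldType) (I : finType) (a : I -> R)
    (s : nat) (D : {set I}) :
  (forall i, 0 <= a i) -> (s <= #|D|)%N ->
  exists N : {set I}, [/\ N \subset D, #|N| = s &
    #|D|%:R * \sum_(i in N) a i <= s%:R * \sum_(i in D) a i].
Proof.
move=> a0; move En : #|D| => n; elim: n D En => [|n IH] D En.
  rewrite leqn0 => /eqP ->; exists D; split=> //.
rewrite leq_eqVlt => /orP[/eqP ->|]; first by exists D; split.
rewrite ltnS => sn.
have /card_gt0P [i0 i0D] : (0 < #|D|)%N by rewrite En.
have [x /= xD xmax] : exists2 x, x \in D & forall i, i \in D -> a i <= a x.
  by have [x] := Order.TotalTheory.arg_maxP a i0D; exists x.
have Ex : #|D :\ x| = n by move: En; rewrite (cardsD1 x) xD => -[].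
have [N [ND Ns Nle]] := IH _ Ex sn.
exists N; split => //.
  exact: fintype.subset_trans ND (finset.subsetDl _ _).
have sumx : \sum_(i in D) a i = a x + \sum_(i in D :\ x) a i.
  by rewrite (big_setD1 x).
have ax : \sum_(i in D :\ x) a i <= n%:R * a x.
  rewrite -Ex mulr_natl -sumr_const; apply: ler_sum => i.
  by rewrite in_setD1 => /andP[_ iD]; exact: xmax.
(* The induction hypothesis carries the factor [n], which must be positive to be cancelled below. *)
case: (posnP n) => [n0|n0].
  move: sn Ns; rewrite n0 leqn0 => /eqP -> /eqP; rewrite cards_eq0 => /eqP ->.
  by rewrite big_set0 mulr0 mul0r.
have nR : 0 < n%:R :> R by rewrite ltr0n.
rewrite sumx -(ler_pM2l nR) -natr1.
have s0 : 0 <= s%:R :> R by rewrite ler0n.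
have : (n%:R + 1) * (n%:R * \sum_(i in N) a i) <=
   (n%:R + 1) * (s%:R * \sum_(i in D :\ x) a i).
  by apply: ler_wpM2l => //; lra.
have : s%:R * \sum_(i in D :\ x) a i <= s%:R * (n%:R * a x).
  exact: ler_wpM2l.
lra.
Qed.

(** * Gram matrix, L_2(Q)-norms and largest eigenvalues *)

Section L2Facts.
Context {d : measure_display} {T : measurableType d} {R : realType}.
Variable Q : probability T R.

Lemma L2norm_sqr (f : T -> R) : L2norm Q f ^+ 2 = \int[Q]_x (f x ^+ 2).
Proof.
rewrite /L2norm /Rintegral.
have -> : (\int[Q]_x (f x ^+ 2)%:E = 'N[Q]_2%:E[EFin \o f] `^ 2)%E.
  rewrite poweR_Lnorm ?pnatr_eq0//; apply: eq_integral => x _.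
  by rewrite /= powR_mulrn// real_normK// num_real.
have := Lnorm_ge0 Q 2%:E (EFin \o f).
(* If the norm is [+oo], both sides are 0, because [fine] sends [+oo] to 0. *)
case: (Lnorm _ _ _) => [r r0|_|//] /=; first by rewrite powR_mulrn.
by rewrite expr0n pnatr_eq0.
Qed.

Lemma Rintegral_sum (I : finType) (F : I -> T -> R) :
  (forall i, Q.-integrable setT (EFin \o F i)) ->
  \int[Q]_x (\sum_i F i x) = \sum_i \int[Q]_x F i x.
Proof.
move=> Fint; rewrite /Rintegral.
under eq_integral do rewrite -sumEFin.
rewrite integral_sum//= -sum_fine// => i _.
exact: (integrable_fin_num measurableT (Fint i)).
Qed.

Context {p : nat}.
Variable psi : 'I_p -> T -> R.
Hypothesis psi_L2 : forall j, psi j \in Lfun Q 2%:E.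
Implicit Types (b u v : 'cV[R]_p) (S : {set 'I_p}).
Let G := gram Q psi.

Lemma gram_sym : G^T = G.
Proof.
apply/matrixP => i j; rewrite !mxE; congr fine; apply: eq_integral => x _.
by rewrite mulrC.
Qed.

Lemma flinB u v : flin psi u \- flin psi v = flin psi (u - v).
Proof.
apply/funext => x; rewrite /flin /= -sumrB; apply: eq_bigr => j _.
by rewrite !mxE mulrBr.
Qed.

Lemma L2norm_flin b : L2norm Q (flin psi b) ^+ 2 = bform G b b.
Proof.
have intpsi j k : Q.-integrable setT (EFin \o (psi j \* psi k)).
  by apply/Lfun1_integrable; exact: Lfun2_mul_Lfun1.
pose F (jk : 'I_p * 'I_p) x := b jk.1 0 * b jk.2 0 * (psi jk.1 x * psi jk.2 x).
have -> : L2norm Q (flin psi b) ^+ 2 = \int[Q]_x (\sum_jk F jk x).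
  rewrite L2norm_sqr; congr fine; apply: eq_integral => x _; congr EFin.
  rewrite -(pair_bigA _ (fun j k => F (j, k) x)) /= expr2 /flin mulr_suml.
  apply: eq_bigr => j _; rewrite mulr_sumr; apply: eq_bigr => k _.
  by rewrite /F/=; ring.
rewrite Rintegral_sum => [|[j k]]; last first.
  by have := integrableZl measurableT (b j 0 * b k 0) (intpsi j k).
rewrite bform_sum exchange_big pair_bigA; apply: eq_bigr => -[j k] _ /=.
rewrite RintegralZl//; last exact: intpsi.
by rewrite mxE; ring.
Qed.

Lemma bform_gram_ge0 b : 0 <= bform G b b.
Proof. by rewrite -L2norm_flin sqr_ge0. Qed.

(** Needed for [sup] to dominate its set. Coordinates of a unit vector are at most 1 in absolute
    value, hence the entrywise bound. *)
Lemma Lambda_max2_has_ubound S :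
  has_ubound [set ((restr S b)^T *m G *m restr S b) 0 0
             | b in [set b | l2norm (restr S b) = 1]].
Proof.
exists (\sum_k \sum_j `|G j k|) => _ [b /= b1 <-].
have bj j : `|restr S b j 0| <= 1.
  rewrite -(@ler_pXn2r _ 2) ?nnegrE// real_normK ?num_real// expr1n.
  have <- : \sum_j restr S b j 0 ^+ 2 = 1.
    rewrite -[LHS]sqr_sqrtr -/(l2norm _) ?b1 ?expr1n//.
    by apply: sumr_ge0 => i _; exact: sqr_ge0.
  by rewrite (bigD1 j)//= lerDl; apply: sumr_ge0 => i _; exact: sqr_ge0.
rewrite -/(bform G _ _) bform_sum; apply: ler_sum => k _; apply: ler_sum => j _.
apply: (le_trans (ler_norm _)); rewrite !normrM mulrAC.
by rewrite ler_piMl// mulr_ile1.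
Qed.

Lemma Lambda_max2_ge0 S : 0 <= Lambda_max2 Q psi S.
Proof.
rewrite /Lambda_max2 -/G; case: ifPn => // _.
(* Without a supremum, [sup] takes the default value 0. *)
set E := (X in sup X); have [hs|/sup_out -> //] := pselect (has_sup E).
have [[_ [b b1 _]] _] := hs.
apply: le_trans (ub_le_sup (Lambda_max2_has_ubound S) _); last by exists b.
exact: bform_gram_ge0.
Qed.

(** By homogeneity, rescale [b] to the unit sphere; the zero vector is treated apart. *)
Lemma bform_le_Lambda_max2 S b : supp b \subset S ->
  bform G b b <= Lambda_max2 Q psi S * \sum_j b j 0 ^+ 2.
Proof.
move=> bS; have restrb c : restr S (c *: b) = c *: b.
  apply/matrixP => j k; rewrite ord1 !mxE; case: ifPn => // jS.
  suff /eqP -> : b j 0 == 0 by rewrite mulr0.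
  by apply: contraNT jS => bj; apply: (fintype.subsetP bS); rewrite inE.
have s0 : 0 <= \sum_j b j 0 ^+ 2 by apply: sumr_ge0 => j _; exact: sqr_ge0.
have [sb0|sb0] := eqVneq (\sum_j b j 0 ^+ 2) 0.
  have b0 : b = 0.
    apply/matrixP => j k; rewrite ord1 mxE; apply/eqP; rewrite -sqrf_eq0.
    by rewrite (psumr_eq0P _ sb0)// => i _; exact: sqr_ge0.
  by rewrite sb0 mulr0 b0 -(scale0r 0) bformZl mul0r.
have sbp : 0 < \sum_j b j 0 ^+ 2 by rewrite lt_def sb0.
rewrite /Lambda_max2 -/G; case: ifPn => [/eqP S0|_].
  exfalso; move/eqP: sb0; apply; apply: big1 => j _.
  have : j \notin supp b by apply/negP => /(fintype.subsetP bS); rewrite S0 inE.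
  by rewrite inE negbK => /eqP ->; rewrite expr0n.
set r := Num.sqrt (\sum_j b j 0 ^+ 2).
have rp : 0 < r by rewrite sqrtr_gt0.
have r2 : r ^+ 2 = \sum_j b j 0 ^+ 2 by rewrite sqr_sqrtr.
rewrite -ler_pdivrMr//.
apply: le_trans (ub_le_sup (Lambda_max2_has_ubound S) _); last first.
  exists (r^-1 *: b) => //=; rewrite restrb /l2norm.
  under eq_bigr do rewrite mxE exprMn.
  by rewrite -mulr_sumr -r2 -exprMn mulVf ?gt_eqF// expr1n sqrtr1.
by rewrite restrb -/(bform G _ _) bformZl bformZr mulrA -r2 mulrC -expr2 exprVn.
Qed.

Lemma Lambda_max2_le_sparse S :
  Lambda_max2 Q psi S <= Lambda_sparse Q psi #|S| ^+ 2.
Proof.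
rewrite -[leLHS]sqr_sqrtr ?Lambda_max2_ge0//.
rewrite ler_pXn2r ?nnegrE ?sqrtr_ge0//; last first.
  exact: bigmax_ge_id.
by apply: (le_bigmax_cond _ (fun S => Lambda_max Q psi S)).
Qed.

End L2Facts.

(** * Stationarity of the weighted Lasso and the resulting cardinality bound *)

Section WeightedLasso.
Context {d : measure_display} {T : measurableType d} {R : realType}.
Variables (Q : probability T R) (p : nat) (psi : 'I_p -> T -> R).
Hypothesis psi_L2 : forall j, psi j \in Lfun Q 2%:E.
Variables (b0 : 'cV[R]_p) (li lw : R) (w : 'I_p -> R) (b : 'cV[R]_p).
Hypothesis li_gt0 : 0 < li.
Hypothesis lw_gt0 : 0 < lw.
Hypothesis bmin : is_weighted_lasso Q psi li lw w (flin psi b0) b.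
Let G := gram Q psi.

Lemma weighted_lasso_kkt j : b j 0 != 0 ->
  2 * bform G (delta_mx j 0) (b - b0) + li * lw * w j * Num.sg (b j 0) = 0.
Proof.
move=> bj; set c := (X in X = 0).
(* For such [t] the [j]-th coordinate does not cross 0, so its absolute value is affine in [t] and
   the criterion changes by exactly this quadratic. It remains to see that its slope [c] at 0
   vanishes. *)
have line t : `|t| <= `|b j 0| -> 0 <= t * c + t ^+ 2 * G j j.
  move=> tb; have := bmin (b + t *: delta_mx j 0).
  rewrite /weighted_lasso_crit !flinB !L2norm_flin// -/G.
  have -> : b + t *: delta_mx j 0 - b0 = (b - b0) + t *: delta_mx j 0.
    by rewrite addrAC.
  rewrite (bform_line (gram_sym Q psi)) -/G.
  have -> : bform G (delta_mx j 0) (delta_mx j 0) = G j j.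
    by rewrite /bform trmx_delta -rowE -colE !mxE.
  have -> : \sum_k w k * `|(b + t *: delta_mx j 0) k 0| =
      \sum_k w k * `|b k 0| + w j * (t * Num.sg (b j 0)).
    rewrite (bigD1 j)//= [in RHS](bigD1 j)//= [in RHS]addrAC; congr (_ + _).
      rewrite !mxE !eqxx mulr1 -mulrDr; congr (_ * _).
      move: tb; have [bp|bn|/eqP] := ltrgt0P (b j 0);
        last by rewrite (negbTE bj).
        by rewrite ler_norml => /andP[t1 t2]; rewrite gtr0_sg// ger0_norm; lra.
      by rewrite ler_norml => /andP[t1 t2]; rewrite ltr0_sg// ler0_norm; lra.
    apply: eq_bigr => k kj; rewrite !mxE (negbTE kj) mulr0 addr0//.
  rewrite /c (bformC (gram_sym Q psi) (delta_mx j 0)) -/G; lra.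
have Gjj : 0 <= G j j.
  have := bform_gram_ge0 psi_L2 (delta_mx j 0).
  by rewrite /bform trmx_delta -rowE -colE !mxE.
apply/eqP/negPn/negP => c0.
have cp : 0 < `|c| by rewrite normr_gt0.
have bp : 0 < `|b j 0| by rewrite normr_gt0.
(* The step [t = - (e * c)] is to lower the criterion: the first bound keeps it in the range of
   [line], the second gives [e * G j j < 1]. The [+ 1] keeps the denominator positive. *)
pose e := Num.min (`|b j 0| / `|c|) (2 * (G j j + 1))^-1.
have ep : 0 < e by rewrite lt_min divr_gt0//= invr_gt0; lra.
have e1 : e * `|c| <= `|b j 0| by rewrite -ler_pdivlMr// ge_min lexx.
have e2 : e * (2 * (G j j + 1)) <= 1.
  by rewrite -ler_pdivlMr ?mul1r ?ge_min ?lexx ?orbT//; lra.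
have := line (- (e * c)); rewrite normrN normrM gtr0_norm// => /(_ e1).
have -> : - (e * c) * c + (- (e * c)) ^+ 2 * G j j =
    (e * c ^+ 2) * (e * G j j - 1) by ring.
rewrite pmulr_rge0; first by nra.
by rewrite mulr_gt0// exprn_even_gt0.
Qed.

(** Stated for any part [N] of the support because it serves both claims, with different [N]. *)
Lemma weighted_lasso_card (N : {set 'I_p}) : N \subset supp b ->
  (forall j, j \in N -> w j != 0) ->
  #|N|%:R ^+ 2 <= 4 * Lambda_max2 Q psi N *
    (L2norm Q (flin psi b \- flin psi b0) ^+ 2 / lw ^+ 2) *
    (inv_weight_norm2 w N / li ^+ 2).
Proof.
move=> Nb wN.
have bN j : j \in N -> b j 0 != 0 by move=> /(fintype.subsetP Nb); rewrite inE.
(* Pairing with [v] adds up the stationarity equations divided by [w j]; the signs square to 1, so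
   each [j] in [N] contributes the same constant. *)
pose v : 'cV[R]_p := \col_j (if j \in N then Num.sg (b j 0) / w j else 0).
have Bv : bform G v (b - b0) = - (li * lw / 2) * #|N|%:R.
  rewrite bform_suml -[#|N|%:R]mulr1 mulr_natl -sumr_const [in RHS]mulr_sumr.
  rewrite [RHS]big_mkcond; apply: eq_bigr => j _; rewrite mxE.
  case: ifPn => [jN|_]; last by rewrite mul0r.
  have kkt := weighted_lasso_kkt (bN _ jN).
  have -> : bform G (delta_mx j 0) (b - b0) =
    - (li * lw * w j * Num.sg (b j 0)) / 2.
    by lra.
  have sg2 : Num.sg (b j 0) ^+ 2 = 1 by rewrite sqr_sg bN.
  transitivity (- (li * lw / 2) * Num.sg (b j 0) ^+ 2);
    last by rewrite sg2 mulr1.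
  by field; exact: wN.
have vv : \sum_j v j 0 ^+ 2 = inv_weight_norm2 w N.
  rewrite /inv_weight_norm2 [RHS]big_mkcond; apply: eq_bigr => j _; rewrite mxE.
  case: ifPn => [jN|_]; last by rewrite expr0n.
  by rewrite exprMn sqr_sg bN// mul1r exprVn.
have vN : supp v \subset N.
  by apply/fintype.subsetP => j; rewrite inE mxE; case: ifPn => //;
    rewrite eqxx.
have := bform_CauchySchwarz (gram_sym Q psi) v (b - b0) (bform_gram_ge0 psi_L2).
rewrite -/G Bv flinB -(L2norm_flin psi_L2 (b - b0)); set F := L2norm Q _ => CS.
have le1 := ler_wpM2r (sqr_ge0 F) (bform_le_Lambda_max2 Q psi vN).
move: (le_trans CS le1); rewrite vv.
set L := Lambda_max2 _ _ _; set I := inv_weight_norm2 _ _.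
have -> : 4 * L * (F ^+ 2 / lw ^+ 2) * (I / li ^+ 2) =
    (L * I * F ^+ 2) / (li * lw / 2) ^+ 2.
  by field; rewrite !gt_eqF.
by rewrite exprMn sqrrN ler_pdivlMr ?exprn_gt0 ?divr_gt0 ?mulr_gt0// mulrC.
Qed.

End WeightedLasso.

(** * The two bounds on the number of falsely selected variables *)

Theorem lemma6p1
  (R : realType) (d : measure_display) (T : measurableType d)
  (Q : probability T R) (p : nat) (psi : 'I_p -> T -> R)
  (psi_L2 : forall j, psi j \in Lfun Q 2%:E)
  (psi_norm1 : forall j, \int[Q]_x (psi j x ^+ 2) = 1)
  (beta_true : 'cV[R]_p)
  (lambda_init lambda_weight : R)
  (lambda_init_gt0 : 0 < lambda_init)
  (lambda_weight_gt0 : 0 < lambda_weight)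
  (fS : {set 'I_p} -> T -> R)
  (fS_proj : forall S : {set 'I_p},
     is_projection Q psi S (flin psi beta_true) (fS S))
  (S0 : {set 'I_p})
  (S0_oracle : is_oracle_set Q psi lambda_init (flin psi beta_true) fS
                 (supp beta_true) S0)
  (w : 'I_p -> R) (w_ge0 : forall j, 0 <= w j)
  (beta_weight : 'cV[R]_p)
  (beta_weight_argmin :
     is_weighted_lasso Q psi lambda_init lambda_weight w
       (flin psi beta_true) beta_weight) :
  let f0 := flin psi beta_true in
  let f_weight := flin psi beta_weight in
  let s0 := #|S0| in
  let D := (supp beta_weight :\: S0)%SET in
  ((#|D|%:R ^+ 2)%:E <=
     infty_if_zero_weight w D
       (4 * Lambda_max2 Q psi D
        * (L2norm Q (f_weight \- f0) ^+ 2 / lambda_weight ^+ 2)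
        * (inv_weight_norm2 w D / lambda_init ^+ 2))%R)%E
  /\
  ((1 <= s0)%N -> (s0 < #|D|)%N ->
   ((#|D|%:R)%:E <=
     infty_if_zero_weight w D
       (8 * Lambda_sparse Q psi s0 ^+ 2
        * (L2norm Q (f_weight \- f0) ^+ 2 / (lambda_weight ^+ 2 * s0%:R))
        * (inv_weight_norm2 w D / lambda_init ^+ 2))%R)%E).

Proof.
move=> f0 f_weight s0 D.
have DS : D \subset supp beta_weight by exact: finset.subsetDl.
rewrite /infty_if_zero_weight; case: ifPn => [_|]; first by rewrite !leey.
rewrite negb_exists => /forallP w0.
have wD j : j \in D -> w j != 0 by move=> jD; have := w0 j; rewrite jD.
split=> [|s0_gt0 s0D]; rewrite lee_fin.
  by apply: weighted_lasso_card.
have a_ge0 j : 0 <= (w j ^+ 2)^-1 by rewrite invr_ge0 sqr_ge0.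
have [N [ND Ns Nle]] := exists_small_subset a_ge0 (ltnW s0D).
have := weighted_lasso_card psi_L2 lambda_init_gt0 lambda_weight_gt0
  beta_weight_argmin (fintype.subset_trans ND DS)
  (fun j jN => wD j (fintype.subsetP ND j jN)).
have := Lambda_max2_le_sparse psi_L2 N.
rewrite Ns -/f0 -/f_weight -!/(inv_weight_norm2 w _) in Nle *.
set L := Lambda_max2 _ _ _; set M := Lambda_sparse _ _ _ ^+ 2.
set F := L2norm _ _ => LM card_N.
have s0R : 0 < s0%:R :> R by rewrite ltr0n.
have inv_ge0 S : 0 <= inv_weight_norm2 w S by exact: sumr_ge0.
have le_s0 : s0%:R ^+ 2 <= 4 * M * (F ^+ 2 / lambda_weight ^+ 2) *
    (inv_weight_norm2 w N / lambda_init ^+ 2).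
  apply: (le_trans card_N).
  by rewrite !ler_wpM2r ?ler_pM2l// divr_ge0 ?sqr_ge0.
(* [K] collects all factors that do not depend on the index set. *)
set K := 4 * M * (F ^+ 2 / lambda_weight ^+ 2) / lambda_init ^+ 2.
have K_ge0 : 0 <= K.
  by rewrite divr_ge0 ?sqr_ge0// mulr_ge0 ?divr_ge0 ?sqr_ge0// mulr_ge0 ?sqr_ge0.
have {}le_s0 : s0%:R ^+ 2 <= K * inv_weight_norm2 w N.
  by apply: (le_trans le_s0); rewrite [leLHS]mulrA [leLHS]mulrAC.
(* The claimed bound is twice the one proved next; the factor 2 is dropped at the end, using that
   [#|D|%:R] is nonnegative. *)
have -> : 8 * M * (F ^+ 2 / (lambda_weight ^+ 2 * s0%:R)) *
    (inv_weight_norm2 w D / lambda_init ^+ 2) =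
    2 * (K * inv_weight_norm2 w D / s0%:R).
  by rewrite /K; field; rewrite !gt_eqF.
(* With [I] for [inv_weight_norm2 w]: [#|D| * s0^2 <= K * #|D| * I N <= K * s0 * I D]; then cancel
   [s0] twice. *)
have : #|D|%:R <= K * inv_weight_norm2 w D / s0%:R.
  rewrite ler_pdivlMr// -(ler_pM2r s0R).
  have := ler_wpM2l (ler0n R #|D|) le_s0.
  have := ler_wpM2l K_ge0 Nle.
  lra.
have := ler0n R #|D|.
lra.
Qed.
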